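(* Let $f_1(x),f_2(x),\dots,f_s(x)\in R$. Then there exist $d(x)\in R$ and $u_i(x)\in R$ ($i=1,2,\dots,s$) such that $d(x)=\mathrm{ggcd}(f_1(x),f_2(x),\dots,f_s(x))$ and $$f_1(x)u_1(x)+f_2(x)u_2(x)+\cdots+f_s(x)u_s(x)=d(x).$$
   Context: An integer-valued quasi-polynomial is a function $f:\mathbb{Z}\to\mathbb{Z}$ for which there exist a positive integer $T$ and polynomials $f_0,\dots,f_{T-1}\in\mathbb{Z}[x]$ such that $f(Tm+i)=f_i(m)$ for all $m\in\mathbb{Z}$ and $0\le i\le T-1$; one then writes $f=(T,\{f_i\}_{i=0}^{T-1})$ and calls this a representation of $f$. $R$ denotes the commutative ring of all integer-valued quasi-polynomials with pointwise addition and multiplication. For $r\in R$ with representation $(T,\{r_i\}_{i=0}^{T-1})$, $r\succ 0$ means that for every $i=0,\dots,T-1$ the leading coefficient of $r_i$ is positive (in particular each $r_i\neq 0$). Let $f,g\in R$ with $g(n)\neq 0$ for every $n\in\mathbb{Z}$. Then $g$ is called a divisor of $f$, written $g\mid f$, if for every $n\in\mathbb{Z}$ the integer $g(n)$ is a divisor of $f(n)$. An element $d\in R$ is a common divisor of $f_1,\dots,f_s\in R$ if $d\mid f_k$ for every $k=1,\dots,s$; it is a greatest common divisor of $f_1,\dots,f_s$ if it is a common divisor and every common divisor $p\in R$ of $f_1,\dots,f_s$ satisfies $p\mid d$. Any two greatest common divisors differ by an invertible factor of $R$, and $\mathrm{ggcd}(f_1,\dots,f_s)$ denotes the unique greatest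 common divisor $d\in R$ such that $d\succ 0$ or $d=0$.
   Formalization: If the f_i have a common integer zero (e.g. s=1, f_1=x) no gcd exists as defined; so d is the ggcd when they have none, and for all families d is a gcd with divisors allowed zeros (0 dividing only 0), each constituent zero or with positive leading coefficient. *)

(* Defs.v *)
From HB Require Import structures.
From mathcomp Require Import all_boot all_order all_algebra.
(* functions.v makes int -> int a commutative ring, pointwise; boolp gives it
   Leibniz equality as an eqType. *)
From mathcomp Require Import boolp functions.
From mathcomp Require Import zify ring.

Set Implicit Arguments.
Unset Strict Implicit.
Unset Printing Implicit Defensive.

Import Order.TTheory GRing.Theory Num.Theory.
Local Open Scope ring_scope.

(* Constituents are indexed by the residues 0, ..., T - 1, and m ranges over all
   integers, negative ones included. *)
Definition represents (T : nat) (p : 'I_T -> {poly int}) (f : int -> int) :=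
  (0 < T)%N /\ forall (m : int) (i : 'I_T), f (T%:Z * m + i%:Z) = (p i).[m].

Definition quasi_poly : {pred (int -> int)} :=
  fun f => `[< exists (T : nat) (p : 'I_T -> {poly int}), represents p f >].

Lemma quasi_polyP (f : int -> int) :
  f \in quasi_poly <->
  exists2 T : nat, (0 < T)%N &
    forall a : int, exists p : {poly int}, forall m, f (T%:Z * m + a) = p.[m].
Proof.
split.
  move/asboolP => [T [p [T0 Hp]]]; exists T => // a.
  have Tn0 : T%:Z != 0 :> int by lia.
  have a0 := modz_ge0 a Tn0.
  have aT : (`|(a %% T%:Z)%Z| < T)%N by have := ltz_pmod a (d := T%:Z); lia.
  exists ((p (Ordinal aT)) \Po ('X + ((a %/ T%:Z)%Z)%:P)) => m.
  rewrite horner_comp !hornerE -Hp /=; congr f.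
  rewrite gez0_abs // {1}(divz_eq a T%:Z); ring.
move=> [T T0 H]; apply/asboolP; exists T.
have /choice [p Hp] : forall i : 'I_T, exists p : {poly int},
    forall m, f (T%:Z * m + i%:Z) = p.[m] by move=> i; apply: H.
by exists p; split.
Qed.

Lemma quasi_poly_subring : subring_closed quasi_poly.
Proof.
have comb (op : int -> int -> int) (opp : {poly int} -> {poly int} -> {poly int})
    (f g : int -> int) : (forall p q m, (opp p q).[m] = op p.[m] q.[m]) ->
    f \in quasi_poly -> g \in quasi_poly ->
    (fun n => op (f n) (g n)) \in quasi_poly.
  move=> opE /quasi_polyP [S S0 Hf] /quasi_polyP [T T0 Hg].
  apply/quasi_polyP; exists (S * T)%N; first by rewrite muln_gt0 S0 T0.
  move=> a; have [p Hp] := Hf a; have [q Hq] := Hg a.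
  exists (opp (p \Po (T%:Z *: 'X)) (q \Po (S%:Z *: 'X))) => m.
  rewrite opE !horner_comp !hornerE -Hp -Hq PoszM.
  by rewrite [in g _](mulrC S%:Z) -!mulrA.
split.
- apply/quasi_polyP; exists 1%N => // a; exists 1%:P => m; by rewrite hornerC.
- move=> f g; apply: (comb (fun x y => x - y) (fun p q => p - q)) => p q m.
  by rewrite !hornerE.
- move=> f g; apply: (comb (fun x y => x * y) (fun p q => p * q)) => p q m.
  by rewrite !hornerE.
Qed.

Record quasipoly := QuasiPoly { quasi_fun :> int -> int; _ : quasi_fun \in quasi_poly }.

HB.instance Definition _ := [isSub for quasi_fun].
HB.instance Definition _ := [Choice of quasipoly by <:].
HB.instance Definition _ :=
  GRing.SubChoice_isSubComPzRing.Build _ _ quasipoly quasi_poly_subring.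

(* r is succ0 when some representation has only positive leading coefficients;
   succ0_indep below shows that every representation then does. *)
Definition succ0 (r : quasipoly) := exists (T : nat) (p : 'I_T -> {poly int}),
  represents p r /\ forall i, 0 < lead_coef (p i).

(* As lead_coef 0 = 0, each constituent is zero or has positive leading
   coefficient; this includes r = 0, and agrees with succ0 when no constituent
   of r is zero. *)
Definition weak_succ0 (r : quasipoly) := exists (T : nat) (p : 'I_T -> {poly int}),
  represents p r /\ forall i, 0 <= lead_coef (p i).

Lemma horner_int_inj (p q : {poly int}) : (forall m : int, p.[m] = q.[m]) -> p = q.
Proof.
move=> H; apply/eqP; rewrite -subr_eq0; apply/negPn/negP => pq0.
have := @max_poly_roots _ _ [seq (i%:Z) | i <- iota 0 (size (p - q))] pq0.
rewrite size_map size_iota ltnn => K; suff: false by []; apply: K.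
  by apply/allP => x _; rewrite rootE !hornerE H subrr.
by rewrite map_inj_uniq ?iota_uniq // => x y [].
Qed.

Lemma succ0_indep (r : quasipoly) (T : nat) (p : 'I_T -> {poly int}) :
  succ0 r -> represents p r -> forall i, 0 < lead_coef (p i).
Proof.
move=> [S [q [[S0 Hq] q0]]] [T0 Hp] i.
have jS : (i %% S < S)%N by rewrite ltn_mod.
pose c : int := (i %/ S)%N.
have E : p i \Po (S%:Z *: 'X) = q (Ordinal jS) \Po (T%:Z *: 'X + c%:P).
  apply: horner_int_inj => m; rewrite !horner_comp !hornerE -Hp -Hq /=.
  congr (quasi_fun r _); rewrite [X in _ + X = _](_ : _ = c * S%:Z + (i %% S)%N%:Z).
    ring.
  by rewrite {1}(divn_eq i S) PoszD PoszM.
have sX (k : nat) : (0 < k)%N -> size (k%:Z *: 'X : {poly int}) = 2%N.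
  by move=> k0; rewrite size_scale ?size_polyX //; lia.
have cX : (size (c%:P : {poly int}) < 2)%N.
  by rewrite (leq_ltn_trans (size_polyC_leq1 _)).
have := congr1 lead_coef E; rewrite !lead_coef_comp ?size_polyDl ?sX //.
rewrite lead_coefDl ?sX // !lead_coefZ !lead_coefX !mulr1 => eqL.
have := q0 (Ordinal jS).
rewrite -(pmulr_lgt0 _ (exprn_gt0 (size (q (Ordinal jS))).-1 (_ : 0 < T%:Z)));
  last by lia.
by rewrite -eqL pmulr_lgt0 // exprn_gt0 //; lia.
Qed.

Definition divides (g f : quasipoly) :=
  (forall n : int, g n != 0) /\ (forall n : int, (g n %| f n)%Z).

(* Without the condition on g: in MathComp 0 divides only 0, so g n = 0 forces
   f n = 0. The two relations agree whenever g has no zero on int. *)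
Definition weak_divides (g f : quasipoly) := forall n : int, (g n %| f n)%Z.

(* With dvd := divides this is the usual notion of greatest common divisor. If
   the f k have a common integer zero there is no such d (is_gcd_no_common_zero
   below), not even for f = (x) or f = (0); with dvd := weak_divides there is
   always one. The normalization "succ0 d or d = 0" must be relaxed along with
   it: for f equal to 0 on even and 1 on odd integers, the only weak gcds of the
   one-member family (f) vanish exactly on the even integers. *)
Definition is_gcd (dvd : quasipoly -> quasipoly -> Prop) (s : nat) (f : 'I_s -> quasipoly)
    (d : quasipoly) :=
  (forall k, dvd d (f k)) /\ (forall p, (forall k, dvd p (f k)) -> dvd p d).

Definition is_ggcd (s : nat) (f : 'I_s -> quasipoly) (d : quasipoly) :=
  is_gcd divides f d /\ (succ0 d \/ d = 0).

Definition is_weak_ggcd (s : nat) (f : 'I_s -> quasipoly) (d : quasipoly) :=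
  is_gcd weak_divides f d /\ weak_succ0 d.

Lemma polyZ_dvd_sub (p : {poly int}) (x y : int) : (x - y %| p.[x] - p.[y])%Z.
Proof.
elim/poly_ind: p => [|p c IH]; first by rewrite !horner0 subrr dvdz0.
rewrite !hornerE.
have -> : p.[x] * x + c - (p.[y] * y + c) = (p.[x] - p.[y]) * x + p.[y] * (x - y)
  by ring.
exact: rpredD (dvdz_mulr _ IH) (dvdz_mull _ (dvdzz _)).
Qed.

Lemma dvd_common_period (s : nat) (f : 'I_s -> quasipoly) :
  exists2 T : nat, (0 < T)%N &
    forall k (a m : int), (m %| f k (T%:Z * m + a) - f k a)%Z.
Proof.
have H k : exists T : nat, (0 < T)%N /\
    forall a : int, exists p : {poly int}, forall m, f k (T%:Z * m + a) = p.[m].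
  by case: (f k) => g /= /quasi_polyP [T T0 Hg]; exists T.
have [T HT] := choice H; exists (\prod_k T k)%N.
  by rewrite prodn_gt0 // => k; case: (HT k).
move=> k a m; have [_ /(_ a) [p Hp]] := HT k.
rewrite (bigD1 k) //=; set t := (\prod_(i < s | _) _)%N.
have -> : (T k * t)%N%:Z * m + a = (T k)%:Z * (t%:Z * m) + a
  by rewrite PoszM mulrA.
have := Hp 0; rewrite mulr0 add0r Hp => ->.
apply: dvdz_trans (polyZ_dvd_sub _ _ _).
by rewrite subr0 dvdz_mull.
Qed.

Lemma is_gcd_no_common_zero (s : nat) (hs : (0 < s)%N)
    (f : 'I_s -> quasipoly) (d : quasipoly) :
  is_gcd divides f d -> forall n : int, exists k, f k n != 0.
Proof.
move=> [Hd Hmax] n; apply/not_existsP => H0.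
have f0 k : f k n = 0 by apply/eqP; apply: contra_notT (H0 k).
have [T T0 HT] := dvd_common_period f.
pose t := `|d n|.+1%N.
pose g (x : int) : int := if ((T * t)%N%:Z %| x - n)%Z then t%:Z else 1.
have gP : g \in quasi_poly.
  apply/quasi_polyP; exists (T * t)%N; first by rewrite muln_gt0 T0.
  move=> a; exists (g a)%:P => m; rewrite hornerC /g.
  by rewrite -addrA rpredDl // dvdz_mulr.
pose p : quasipoly := QuasiPoly gP.
have pf k : divides p (f k).
  split=> x; rewrite /= /g; case: ifP => // /dvdzP [q /eqP xq].
  have -> : x = T%:Z * (q * t%:Z) + n.
    by apply/eqP; rewrite -subr_eq (eqP xq) PoszM mulrCA mulrA.
  have := HT k n (q * t%:Z); rewrite f0 subr0.
  by apply: dvdz_trans; rewrite dvdz_mull.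
have [Hd0 _] := Hd (Ordinal hs).
have [_ /(_ n)] := Hmax p pf.
rewrite /= /g subrr dvdz0 => /dvdzP [q dq].
have := Hd0 n; rewrite dq; case: (eqVneq q 0) => [->|q0]; first by rewrite mul0r eqxx.
have : (`|d n| = `|q| * t)%N by rewrite dq abszM.
by rewrite /t; nia.
Qed.

(* Main.v *)
Require Import Defs.
From HB Require Import structures.
From mathcomp Require Import all_boot all_order all_algebra.
From mathcomp Require Import boolp.
From mathcomp Require Import zify ring.
Import Order.TTheory GRing.Theory Num.Theory.
Local Open Scope ring_scope.

(** Quasi-polynomials form a Bezout ring because Bezout relations, for pointwise
divisibility, can be found one residue class at a time: solutions on the classes
modulo T are interleaved into a solution on all integers ([quasi_glue],
[bezout_pair_local]). So quasi-polynomials f, g may be replaced by their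
constituents, which are polynomials p, q in Z[x].

For these, let d be the primitive part of their gcd over the rationals. Gauss's
lemma gives p = d p' and q = d q' over Z, and clearing denominators in a rational
Bezout relation gives u p' + v q' = N for some integer N > 0 ([polyZ_bezout]).
At any integer the values of p' and q' therefore have a gcd dividing N, and so
this gcd depends on the residue modulo N alone. On the class of a it is the
constant e = x p'(a) + y q'(a). As p' and q' are constant modulo N on that class,
x p' + y q' = e + N k for some polynomial k, and replacing N by u p' + v q' writes
e as a combination of p' and q' ([bezout_pair_coprime]). Multiplying by d gives
the relation for p and q.

Finite families follow by induction ([bezout_family]). A common divisor that is a
combination of the family is a greatest one. Its sign is then corrected on each
residue class by a quasi-polynomial with values 1 and -1 ([quasi_sign]). *)

Lemma quasi_mulE (f g : quasipoly) (n : int) : (f * g) n = f n * g n.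
Proof. by []. Qed.

Lemma quasi_sumE (I : Type) (r : seq I) (P : pred I) (F : I -> quasipoly) (n : int) :
  (\sum_(i <- r | P i) F i) n = \sum_(i <- r | P i) F i n.
Proof. by elim/big_rec2: _ => // i y x _ <-. Qed.

Lemma quasi_eqP (f g : quasipoly) : (forall n, f n = g n) -> f = g.
Proof. by move=> fg; apply: val_inj; apply: funext. Qed.

Lemma quasi_periodP (f : quasipoly) : exists2 T : nat, (0 < T)%N &
  forall a : int, exists p : {poly int}, forall m, f (T%:Z * m + a) = p.[m].
Proof. by case: f => f /= /quasi_polyP. Qed.

Lemma horner_quasi_subproof (p : {poly int}) : horner p \in quasi_poly.
Proof.
apply/quasi_polyP; exists 1%N => // a; exists (p \Po ('X + a%:P)) => m.
by rewrite horner_comp !hornerE.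
Qed.

Definition horner_quasi (p : {poly int}) := QuasiPoly (horner_quasi_subproof p).

Lemma residue_classP (T : nat) (n : int) : (0 < T)%N ->
  exists (m : int) (i : 'I_T), n = T%:Z * m + i%:Z.
Proof.
move=> T0; have Tn0 : T%:Z != 0 :> int by lia.
have n0 := modz_ge0 n Tn0.
have nT : (`|(n %% T%:Z)%Z| < T)%N by have := ltz_pmod n (d := T%:Z); lia.
exists (n %/ T%:Z)%Z, (Ordinal nT).
by rewrite /= gez0_abs // {1}(divz_eq n T%:Z) mulrC.
Qed.

(** On the class of i modulo T the period of r i gets multiplied by T; the product
of all periods makes them agree. *)
Lemma quasi_glue (T : nat) (r : 'I_T -> quasipoly) : (0 < T)%N ->
  exists h : quasipoly, forall (m : int) (i : 'I_T), h (T%:Z * m + i%:Z) = r i m.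
Proof.
move=> T0; have Tn0 : T%:Z != 0 :> int by lia.
pose h (n : int) :=
  oapp (fun i : 'I_T => r i (n %/ T%:Z)%Z) 0 (insub `|(n %% T%:Z)%Z|%N).
have hE (m : int) (i : 'I_T) : h (T%:Z * m + i%:Z) = r i m.
  have iT : 0 <= i%:Z < T%:Z by have := ltn_ord i; lia.
  (* The remainder of T m + i is i itself, so [insub] gives back the index i. *)
  rewrite /h mulrC modzMDl modz_small; last by [].
  by rewrite absz_nat valK /= divzMDl // divz_small ?addr0 // gez0_abs.
suff hP : h \in quasi_poly by exists (QuasiPoly hP).
have /choice [S HS] : forall i, exists S : nat, (0 < S)%N /\
    forall a : int, exists p : {poly int}, forall m, r i (S%:Z * m + a) = p.[m].
  by move=> i; have [S] := quasi_periodP (r i); exists S.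
apply/quasi_polyP; exists (T * \prod_i S i)%N.
  by rewrite muln_gt0 T0 prodn_gt0 // => i; have [] := HS i.
move=> a; have [b [i ->]] := residue_classP T a T0.
have [_ /(_ b) [p Hp]] := HS i.
pose t := (\prod_(j < T | j != i) S j)%N.
have prodE : (\prod_j S j = S i * t)%N by rewrite (bigD1 i).
exists (p \Po (t%:Z *: 'X)) => m.
rewrite horner_comp hornerZ hornerX -Hp -hE prodE; congr h.
rewrite !PoszM; ring.
Qed.

(** Stated for arbitrary functions, so that restrictions to residue classes, read
as functions of the quotient, are covered without proving that they are again
quasi-polynomials. *)
Definition bezout_pair (f g : int -> int) :=
  exists d u v : quasipoly, forall n : int,
    [/\ d n = f n * u n + g n * v n, (d n %| f n)%Z & (d n %| g n)%Z].

Lemma bezout_pair_local (T : nat) (f g : int -> int) : (0 < T)%N ->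
  (forall a : int, bezout_pair (fun m => f (T%:Z * m + a)) (fun m => g (T%:Z * m + a))) ->
  bezout_pair f g.
Proof.
move=> T0 loc.
have /choice [d /choice [u /choice [v H]]] := fun i : 'I_T => loc i%:Z.
have [[D DE] [U UE] [V VE]] := And3 (quasi_glue T d T0) (quasi_glue T u T0)
  (quasi_glue T v T0).
exists D, U, V => n; have [m [i ->]] := residue_classP T n T0.
by rewrite DE UE VE; apply: H.
Qed.

(** The rational gcd is only defined up to a constant, and its primitive part
is the choice for which Gauss's lemma ([dvdpP_int]) makes both cofactors
integral. The cofactors are coprime over the rationals, whence the nonzero
constant N; it is made positive to serve as a period. *)
Lemma polyZ_bezout (p q : {poly int}) :
  exists (d p' q' u v : {poly int}) (N : nat),
    [/\ (0 < N)%N, p = d * p', q = d * q' & u * p' + v * q' = (N%:Z)%:P].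
Proof.
have [/eqP | g0] := eqVneq (gcdp p q) 0.
  rewrite gcdp_eq0 => /andP[/eqP-> /eqP->].
  (* For p = q = 0 the cofactors are free: 1 and 0 keep them coprime. *)
  by exists 0, 1, 0, 1, 0, 1%N; split; rewrite ?mul0r // mulr1 addr0.
pose d := zprimitive (gcdp p q).
have d0 : d != 0 by rewrite zprimitive_eq0.
have [p' pE] := dvdpP_int (dvdp_gcdl p q).
have [q' qE] := dvdpP_int (dvdp_gcdr p q).
have [[u v] /= /Pdiv.Idomain.eqpP [[c1 c2] /= /andP[c10 c20] uvE]] := Bezoutp p q.
pose c := c2 * zcontents (gcdp p q).
have c0 : c != 0 by rewrite mulf_neq0 // zcontents_eq0.
have E : c1 *: (u * p' + v * q') = c%:P.
  apply: (mulfI d0); rewrite -scalerAr mulrDr !(mulrCA d) -pE -qE uvE.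
  by rewrite {1}[gcdp p q]zpolyEprim scalerA [RHS]mulrC mul_polyC.
(* Scaling by c * c1 turns the constant c into the positive c ^+ 2. *)
exists d, p', q', ((c * c1) *: u), ((c * c1) *: v), `|c ^+ 2|%N; split => //.
  by rewrite absz_gt0 expf_neq0.
rewrite -!scalerAl -scalerDr -scalerA E gez0_abs ?sqr_ge0 //.
by rewrite -mul_polyC -polyCM expr2.
Qed.

Lemma taylor_step (p : {poly int}) (c a : int) :
  exists k : {poly int}, p \Po (c *: 'X + a%:P) = (p.[a])%:P + c *: k.
Proof.
elim/poly_ind: p => [|p b [k IH]].
  by exists 0; rewrite comp_poly0 horner0 scaler0 addr0.
exists (k * (c *: 'X + a%:P) + (p.[a])%:P * 'X).
rewrite comp_poly_MXaddC IH !hornerE -!mul_polyC !(polyCD, polyCM); ring.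
Qed.

(** On the class of a modulo N, write t = N m + a and let e = x p(a) + y q(a) be
the gcd of p(a) and q(a). It divides N = u(a) p(a) + v(a) q(a), hence also p(t)
and q(t), which are congruent to p(a) and q(a) modulo N. Moreover
x p(t) + y q(t) = e + N k(m), and as N = u(t) p(t) + v(t) q(t), the error term
is absorbed: e = (x - k u) p(t) + (y - k v) q(t). *)
Lemma bezout_pair_coprime (p q u v : {poly int}) (N : nat) : (0 < N)%N ->
  u * p + v * q = (N%:Z)%:P -> bezout_pair (horner p) (horner q).
Proof.
move=> N0 uvN; apply: (bezout_pair_local N _ _ N0) => a.
have [x [y xyE]] := Bezoutz p.[a] q.[a].
set e := gcdz p.[a] q.[a] in xyE.
have [kp Hp] := taylor_step p N a; have [kq Hq] := taylor_step q N a.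
pose k := x *: kp + y *: kq.
exists (horner_quasi e%:P),
  (horner_quasi (x%:P - k * (u \Po (N%:Z *: 'X + a%:P)))),
  (horner_quasi (y%:P - k * (v \Po (N%:Z *: 'X + a%:P)))) => m /=.
have tE : (N%:Z *: 'X + a%:P).[m] = N%:Z * m + a.
  by rewrite hornerD hornerZ hornerX hornerC.
rewrite !(hornerD, hornerN, hornerM, hornerC (_ : int)) !horner_comp tE.
move: (congr1 (horner^~ m) Hp) (congr1 (horner^~ m) Hq) => /=.
rewrite !horner_comp tE !hornerD !hornerZ !hornerC => pE qE.
have uvE t : u.[t] * p.[t] + v.[t] * q.[t] = N%:Z.
  by rewrite -!hornerM -hornerD uvN hornerC.
have eN : (e %| N%:Z)%Z.
  by rewrite -(uvE a) rpredD // dvdz_mull // ?dvdz_gcdl ?dvdz_gcdr.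
split.
- rewrite -xyE; move: (uvE (N%:Z * m + a)) pE qE; move: (_ * m + a) => t.
  set us := u.[t]; set vs := v.[t] => us_vs pE qE.
  transitivity (x * p.[t] + y * q.[t] - (x * kp.[m] + y * kq.[m]) * N%:Z).
    by rewrite pE qE; ring.
  by rewrite -us_vs; ring.
- by rewrite pE rpredD ?dvdz_gcdl // dvdz_mulr.
- by rewrite qE rpredD ?dvdz_gcdr // dvdz_mulr.
Qed.

Lemma bezout_pair_poly (p q : {poly int}) : bezout_pair (horner p) (horner q).
Proof.
have [d [p' [q' [u [v [N [N0 -> -> uvN]]]]]]] := polyZ_bezout p q.
have [e [a [b H]]] := bezout_pair_coprime _ _ _ _ _ N0 uvN.
exists (horner_quasi d * e), a, b => n; rewrite quasi_mulE /= !hornerM.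
have [-> ep eq] := H n; split; [ring | |]; exact: dvdz_mul.
Qed.

Lemma bezout_pair_quasi (f g : quasipoly) : bezout_pair f g.
Proof.
have [S S0 Hf] := quasi_periodP f; have [T T0 Hg] := quasi_periodP g.
apply: (bezout_pair_local (S * T)); first by rewrite muln_gt0 S0.
move=> a; have [p Hp] := Hf a; have [q Hq] := Hg a.
have -> : (fun m => f ((S * T)%N%:Z * m + a)) = horner (p \Po (T%:Z *: 'X)).
  by apply: funext => m; rewrite horner_comp !hornerE -Hp mulrA PoszM.
have -> : (fun m => g ((S * T)%N%:Z * m + a)) = horner (q \Po (S%:Z *: 'X)).
  by apply: funext => m; rewrite horner_comp !hornerE -Hq mulrA mulnC PoszM.
exact: bezout_pair_poly.
Qed.

(** The combination for the tail of the family is rescaled by the coefficient that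
the gcd of the tail gets when the first member is added. *)
Lemma bezout_family (s : nat) (f : 'I_s -> quasipoly) :
  exists (d : quasipoly) (u : 'I_s -> quasipoly),
    (forall k, weak_divides d (f k)) /\ \sum_(k < s) f k * u k = d.
Proof.
elim: s f => [|s IH] f; first by exists 0, (fun=> 0); split=> [[]|]; rewrite ?big_ord0.
have [d [u [df dE]]] := IH (fun k => f (lift ord0 k)).
have [e [a [b H]]] := bezout_pair_quasi (f ord0) d.
exists e, (fun k => oapp (fun j => u j * b) a (unlift ord0 k)); split.
  move=> k n; have [_ e0 ed] := H n.
  case: (unliftP ord0 k) => [j ->|-> //]; exact: dvdz_trans ed (df j n).
rewrite big_ord_recl unlift_none /=.
under eq_bigr => j _ do rewrite liftK /= mulrA.
rewrite -mulr_suml dE; apply: quasi_eqP => n; by have [-> _ _] := H n.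
Qed.

(** Dividing by e is the same as multiplying by it, so that passing from d to d e
changes neither the divisors nor the multiples of d. *)
Lemma quasi_sign (d : quasipoly) :
  exists2 e : quasipoly, e * e = 1 & weak_succ0 (d * e).
Proof.
have /asboolP [T [p [T0 Hp]]] : quasi_fun d \in quasi_poly by case: d.
pose sg i : int := (-1) ^+ (lead_coef (p i) < 0)%R.
have [e eE] := quasi_glue T (fun i => horner_quasi (sg i)%:P) T0.
exists e.
  apply: quasi_eqP => n; have [m [i ->]] := residue_classP T n T0.
  by rewrite quasi_mulE eE /= hornerC /sg -expr2 sqrr_sign.
exists T, (fun i => sg i *: p i); split.
  by split=> // m i; rewrite quasi_mulE eE Hp /= hornerC hornerZ mulrC.
by move=> i; rewrite lead_coefZ -normrEsign normr_ge0.
Qed.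

Lemma is_gcd_comb (s : nat) (f u : 'I_s -> quasipoly) (d : quasipoly) :
  (forall k, weak_divides d (f k)) -> \sum_(k < s) f k * u k = d ->
  is_gcd weak_divides f d.
Proof.
move=> df dE; split=> // p pf n; rewrite -dE quasi_sumE.
by apply: rpred_sum => k _; rewrite quasi_mulE; apply: dvdz_mulr; apply: pf.
Qed.

(** A divisor of f k n <> 0 is nonzero at n, so d has no zero on the integers.
A zero constituent would make d vanish on a residue class, hence every leading
coefficient, being nonnegative, is positive. *)
Lemma weak_ggcd_ggcd (s : nat) (f : 'I_s -> quasipoly) (d : quasipoly) :
  is_weak_ggcd f d -> (forall n : int, exists k, f k n != 0) -> is_ggcd f d.
Proof.
move=> [[df dmax] [T [p [[T0 Hp] p0]]]] f0.
have d0 n : d n != 0.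
  have [k] := f0 n; apply: contra => /eqP d0.
  by have := df k n; rewrite d0 dvd0z.
split; first split=> [k|q qf].
- by split=> // n; apply: df.
- split=> n; last by apply: dmax => k m; have [_] := qf k.
  by have [k _] := f0 n; have [] := qf k.
left; exists T, p; split=> // i; rewrite lt_def p0 andbT lead_coef_eq0.
by apply: contra (d0 (T%:Z * 0 + i%:Z)) => /eqP pi0; rewrite Hp pi0 horner0.
Qed.

Theorem theorem21 (s : nat) (hs : (0 < s)%N) (f : 'I_s -> quasipoly) :
  exists (d : quasipoly) (u : 'I_s -> quasipoly),
    [/\ is_weak_ggcd f d,
        ((forall n : int, exists k : 'I_s, f k n != 0) -> is_ggcd f d)
      & \sum_(k < s) f k * u k = d].
Proof.
have [d [u [df dE]]] := bezout_family s f.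
have [e ee1 de0] := quasi_sign d.
have deE : \sum_(k < s) f k * (u k * e) = d * e.
  by rewrite -dE mulr_suml; apply: eq_bigr => k _; rewrite mulrA.
have def k : weak_divides (d * e) (f k).
  move=> n; rewrite -[f k]mulr1 -ee1 mulrA !quasi_mulE.
  by rewrite dvdz_mul // dvdz_mulr //; apply: df.
have dgcd : is_weak_ggcd f (d * e) by split=> //; apply: is_gcd_comb deE.
exists (d * e), (fun k => u k * e); split=> //; exact: weak_ggcd_ggcd.
Qed.
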